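(* Let $p\ge1$ with $p\ne 2$, let $\mu_1,\dots,\mu_k$ be discrete distributions on $\mathbb{R}^d$ each supported on at most $\mathrm{poly}(n)$ points, and let $\varepsilon,\delta\in(0,1)$. Let $\pi:\mathbb{R}^d\to\mathbb{R}^m$ be a JL projection with $m=O(\log(nk/\delta)p^2/\varepsilon^2)$. Then \[\mathbb{P}\Big(\mathrm{cost}_p(\pi S)\in[(1-\varepsilon)\,\mathrm{cost}_p(S),\,(1+\varepsilon)\,\mathrm{cost}_p(S)]\ \text{for all solutions } S\Big)\ge 1-\delta,\] where the probability is over the randomness of $\pi$.
   Context: Wasserstein barycenter problem with support size at most $n$: minimize $\frac1k\sum_i W_p(\mu_i,\nu)^p$ over $\nu$ supported on at most $n$ points. Write $\mu_i=\sum_x a(x)\delta_x$. A solution $(S,w)=(S_1,\dots,S_n,w_1,\dots,w_n)$ comes from the optimal couplings of each $\mu_i$ to a fixed $\nu=\sum_{j=1}^n b_j\delta_{\nu^j}$: $w_j(x)\ge0$ is the mass sent from point $x$ to $\nu^j$ and $S_j=\{x: w_j(x)>0\}$. $\mathrm{cost}_p(S)=\min_{\nu^j\in\mathbb{R}^d}\frac1k\sum_j\sum_{x\in S_j}w_j(x)\|x-\nu^j\|^p$ and $\mathrm{cost}_p(\pi S)=\min_{\tilde\nu^j\in\mathbb{R}^m}\frac1k\sum_j\sum_{x\in S_j}w_j(x)\|\pi(x)-\tilde\nu^j\|^p$. A JL projection is a random linear map (e.g. scaled Gaussian or sub-Gaussian matrix) satisfying the Johnson–Lindenstrauss lemma 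guarantee.
   Formalization: The formal theorem assumes nk/δ ≥ 2, which leaves out only n = k = 1 with δ in (1/2,1); there log(nk/δ) tends to 0 as δ tends to 1, so the bound on m permits projections (e.g. zero with m = 1) for which the claim fails. *)

(* Defs.v *)
From HB Require Import structures.
From mathcomp Require Export all_boot all_order all_algebra.
From mathcomp Require Export finmap.
From mathcomp Require Export all_classical all_reals all_analysis.

Set Implicit Arguments.
Unset Strict Implicit.
Unset Printing Implicit Defensive.

Import Order.TTheory GRing.Theory Num.Theory.
Import numFieldNormedType.Exports.

Local Open Scope classical_set_scope.
Local Open Scope ring_scope.

(* The library norm `|v| on 'rV[R]_d is the sup norm, hence this definition. *)
Definition enorm (R : realType) (d : nat) (v : 'rV[R]_d) : R :=
  Num.sqrt (\sum_(i < d) v ord0 i ^+ 2).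

(* Finitely supported mass functions a, standing for \sum_x a(x) delta_x. *)
Definition mass_fun (R : realType) (d : nat) := {fsfun 'rV[R]_d -> R with 0}.

Definition is_discrete_distribution (R : realType) (d : nat)
    (mu : mass_fun R d) : Prop :=
  (forall x, 0 <= mu x) /\ \sum_(x <- finsupp mu) mu x = 1.

Section Transport.
Variables (R : realType) (d n : nat) (p : R).

(* g x j is the mass sent from x to the j-th atom of
   \sum_j b j delta_(nu j); atoms are allowed to coincide. *)
Definition is_coupling (mu : mass_fun R d) (b : 'I_n -> R)
    (g : 'rV[R]_d -> 'I_n -> R) : Prop :=
  [/\ forall x j, 0 <= g x j,
      forall x, \sum_(j < n) g x j = mu x &
      forall j, \sum_(x <- finsupp mu) g x j = b j].

Definition transport_cost (mu : mass_fun R d) (nu : 'I_n -> 'rV[R]_d)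
    (g : 'rV[R]_d -> 'I_n -> R) : R :=
  \sum_(x <- finsupp mu) \sum_(j < n) g x j * enorm (x - nu j) `^ p.

Definition is_optimal_coupling (mu : mass_fun R d) (nu : 'I_n -> 'rV[R]_d)
    (b : 'I_n -> R) (g : 'rV[R]_d -> 'I_n -> R) : Prop :=
  is_coupling mu b g /\
  forall g', is_coupling mu b g' ->
    transport_cost mu nu g <= transport_cost mu nu g'.

(* w j x is the total mass sent from x to nu j; a point x lying in the supports
   of several mu i contributes the sum of the corresponding masses. *)
Definition is_solution (k : nat) (mu : 'I_k -> mass_fun R d)
    (w : 'I_n -> 'rV[R]_d -> R) : Prop :=
  exists (nu : 'I_n -> 'rV[R]_d) (b : 'I_n -> R)
         (g : 'I_k -> 'rV[R]_d -> 'I_n -> R),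
    [/\ forall j, 0 <= b j,
        \sum_(j < n) b j = 1,
        forall i, is_optimal_coupling (mu i) nu b (g i) &
        forall j x, w j x = \sum_(i < k) g i x j].

Definition solution_set (w : 'I_n -> 'rV[R]_d -> R) (j : 'I_n) :
    set 'rV[R]_d := [set x | 0 < w j x].

Definition cost_image (k m : nat) (f : 'rV[R]_d -> 'rV[R]_m)
    (w : 'I_n -> 'rV[R]_d -> R) : R :=
  inf [set c | exists nu : 'I_n -> 'rV[R]_m,
    c = k%:R^-1 * \sum_(j < n) \sum_(x \in solution_set w j)
                    w j x * enorm (f x - nu j) `^ p].

Definition cost (k : nat) (w : 'I_n -> 'rV[R]_d -> R) : R :=
  cost_image k id w.

Definition cost_proj (k m : nat) (A : 'M[R]_(d, m))
    (w : 'I_n -> 'rV[R]_d -> R) : R :=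
  cost_image k (fun x => x *m A) w.

End Transport.

(* "P(E) >= r" for an E not known to be measurable: a measure of the library is
   unconstrained outside measurable sets, so E must contain a measurable event
   of probability at least r. For measurable E this is exactly r <= P E. *)
Definition prob_ge (R : realType) (disp : measure_display)
    (T : measurableType disp) (P : probability T R) (E : set T) (r : R) : Prop :=
  exists A : set T, [/\ measurable A, A `<=` E & (r%:E <= P A)%E].

(* Random matrices acting on row vectors on the right, with measurable entries,
   that satisfy the conclusion of the Johnson-Lindenstrauss lemma (constant C0)
   for every finite set X and all accuracies e and failure probabilities q for
   which the target dimension m is at least C0 * log(#|X| / q) / e^2. *)
Definition is_JL_projection (R : realType) (C0 : R) (d m : nat)
    (disp : measure_display) (T : measurableType disp) (P : probability T R)
    (pi : T -> 'M[R]_(d, m)) : Prop :=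
  (forall i j, measurable_fun setT (fun t => pi t i j)) /\
  forall (X : {fset 'rV[R]_d}) (e q : R),
    (0 < #|` X|)%N -> 0 < e < 1 -> 0 < q < 1 ->
    C0 * ln (#|` X|%:R / q) / e ^+ 2 <= m%:R ->
    prob_ge P
      [set t | forall x y, x \in X -> y \in X ->
         (1 - e) * enorm (x - y) <= enorm (x *m pi t - y *m pi t)
           <= (1 + e) * enorm (x - y)]
      (1 - q).

(* Main.v *)
(* A solution enters the costs only through weights w >= 0 carried by the union
   X of the supports, a set of at most k K n^c points whose pairwise distances
   are all preserved up to a factor 1 +- eps / (2 p). By Kirszbraun's theorem both
   the projection restricted to X and its inverse extend, with the same Lipschitz
   constant, to each candidate center, so every choice of centers on one side is
   matched on the other side at a cost larger by at most the p-th power of that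
   constant. *)
Require Import Defs.
From mathcomp Require Import all_boot all_order all_algebra.
From mathcomp Require Import finmap.
From mathcomp Require Import all_classical all_reals all_analysis.
From mathcomp Require Import ring lra.

Set Implicit Arguments.
Unset Strict Implicit.
Unset Printing Implicit Defensive.

Import Order.TTheory GRing.Theory Num.Theory.
Import numFieldNormedType.Exports.

Local Open Scope classical_set_scope.
Local Open Scope ring_scope.

(** * Euclidean inner product and weighted variance *)

Section EuclideanDot.
Variable R : realType.
Implicit Types d N : nat.

Definition edot d (u v : 'rV[R]_d) : R := \sum_(i < d) u ord0 i * v ord0 i.

Lemma edotC d (u v : 'rV[R]_d) : edot u v = edot v u.
Proof. by apply: eq_bigr => i _; rewrite mulrC. Qed.

Lemma edotDl d (u v z : 'rV[R]_d) : edot (u + v) z = edot u z + edot v z.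
Proof. by rewrite -big_split; apply: eq_bigr => i _; rewrite mxE mulrDl. Qed.

Lemma edotZl d (a : R) (u z : 'rV[R]_d) : edot (a *: u) z = a * edot u z.
Proof. by rewrite mulr_sumr; apply: eq_bigr => i _; rewrite mxE mulrA. Qed.

Lemma edotNl d (u z : 'rV[R]_d) : edot (- u) z = - edot u z.
Proof. by rewrite -scaleN1r edotZl mulN1r. Qed.

Lemma edotDr d (u v z : 'rV[R]_d) : edot z (u + v) = edot z u + edot z v.
Proof. by rewrite edotC edotDl !(edotC z). Qed.

Lemma edotZr d (a : R) (u z : 'rV[R]_d) : edot z (a *: u) = a * edot z u.
Proof. by rewrite edotC edotZl edotC. Qed.

Lemma edotNr d (u z : 'rV[R]_d) : edot z (- u) = - edot z u.
Proof. by rewrite edotC edotNl edotC. Qed.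

Lemma edot_mulmxl d N (c : 'rV[R]_N) (A : 'M[R]_(N, d)) (z : 'rV[R]_d) :
  edot (c *m A) z = \sum_(i < N) c ord0 i * edot (row i A) z.
Proof.
rewrite mulmx_sum_row; elim/big_ind2: _ => [|u a v b <- <-|i _].
- by rewrite /edot big1 // => i _; rewrite mxE mul0r.
- by rewrite edotDl.
- by rewrite edotZl.
Qed.

Lemma edot_ge0 d (u : 'rV[R]_d) : 0 <= edot u u.
Proof. by apply: sumr_ge0 => i _; rewrite -expr2 sqr_ge0. Qed.

Lemma sqr_enorm d (u : 'rV[R]_d) : enorm u ^+ 2 = edot u u.
Proof. by rewrite /enorm sqr_sqrtr // sumr_ge0 // => i _; exact: sqr_ge0. Qed.

Lemma enorm_ge0 d (u : 'rV[R]_d) : 0 <= enorm u.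
Proof. exact: sqrtr_ge0. Qed.

Lemma enormZ d (a : R) (u : 'rV[R]_d) : 0 <= a -> enorm (a *: u) = a * enorm u.
Proof.
move=> a0; apply/eqP; rewrite -(@eqrXn2 _ 2) ?mulr_ge0 ?enorm_ge0 //.
by rewrite exprMn !sqr_enorm edotZl edotZr mulrA expr2.
Qed.

Lemma enormBC d (u v : 'rV[R]_d) : enorm (u - v) = enorm (v - u).
Proof.
by congr Num.sqrt; apply: eq_bigr => i _; rewrite !mxE -sqrrN opprB.
Qed.

(** Variance identity: for weights of total one, the spread around the barycentre [c *m A] is
    determined by the pairwise distances, which are what a contraction between point sets
    controls. *)
Lemma weighted_pairwise_edot d N (c : 'rV[R]_N) (A : 'M[R]_(N, d)) :
  \sum_(i < N) c ord0 i = 1 ->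
  \sum_(i < N) \sum_(j < N) c ord0 i * c ord0 j *
      edot (row i A - row j A) (row i A - row j A) =
  2 * (\sum_(i < N) c ord0 i * edot (row i A) (row i A)
       - edot (c *m A) (c *m A)).
Proof.
move=> c1; set V := \sum_i c ord0 i * edot (row i A) (row i A).
have E : edot (c *m A) (c *m A) =
    \sum_(i < N) \sum_(j < N) c ord0 i * c ord0 j * edot (row i A) (row j A).
  rewrite edot_mulmxl; apply: eq_bigr => i _.
  rewrite edotC edot_mulmxl mulr_sumr; apply: eq_bigr => j _.
  by rewrite edotC mulrA.
have Vl : V = \sum_(i < N) \sum_(j < N)
    c ord0 i * c ord0 j * edot (row i A) (row i A).
  apply: eq_bigr => i _; rewrite -mulr_suml -mulr_sumr c1 mulr1 //.
have Vr : V = \sum_(i < N) \sum_(j < N)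
    c ord0 i * c ord0 j * edot (row j A) (row j A).
  rewrite Vl exchange_big /=; apply: eq_bigr => i _; apply: eq_bigr => j _.
  by rewrite (mulrC (c ord0 j)).
have -> : 2 * (V - edot (c *m A) (c *m A)) =
  V + V - edot (c *m A) (c *m A) *+ 2 by ring.
rewrite {1}Vl Vr E -sumrMnl -big_split -sumrB; apply: eq_bigr => i _.
rewrite -sumrMnl -big_split -sumrB; apply: eq_bigr => j _ /=.
rewrite !(edotDl, edotDr, edotNl, edotNr) (edotC (row j A) (row i A)).
by ring.
Qed.

(** The gap between the two sides is [edot (x - c *m A) (x - c *m A)]: the barycentre minimises the
    weighted second moment. *)
Lemma weighted_edot_ge d N (c : 'rV[R]_N) (A : 'M[R]_(N, d)) (x : 'rV[R]_d) :
  \sum_(i < N) c ord0 i = 1 ->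
  \sum_(i < N) c ord0 i * edot (row i A) (row i A) - edot (c *m A) (c *m A) <=
  \sum_(i < N) c ord0 i * edot (x - row i A) (x - row i A).
Proof.
move=> c1.
have -> : \sum_(i < N) c ord0 i * edot (x - row i A) (x - row i A) =
    edot x x - 2 * edot (c *m A) x
    + \sum_(i < N) c ord0 i * edot (row i A) (row i A).
  rewrite edot_mulmxl mulr_sumr.
  rewrite -[edot x x in RHS]mul1r -[X in X * edot x x]c1 mulr_suml.
  rewrite -sumrB -big_split; apply: eq_bigr => i _ /=.
  rewrite !(edotDl, edotDr, edotNl, edotNr) (edotC x (row i A)).
  by ring.
have := edot_ge0 (x - c *m A).
rewrite !(edotDl, edotDr, edotNl, edotNr) (edotC x (c *m A)).
by lra.
Qed.

(** * The simplex and the one-point Kirszbraun extension *)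

Definition simplex N : set 'rV[R]_N :=
  [set c | (forall i, 0 <= c ord0 i) /\ \sum_(i < N) c ord0 i = 1].

Lemma continuous_sum (T : topologicalType) N (F : 'I_N -> T -> R) :
  (forall i, continuous (F i)) -> continuous (fun c => \sum_(i < N) F i c).
Proof.
by move=> Fc; apply: continuous_big => // x; exact: add_continuous.
Qed.

Lemma continuous_edot (T : topologicalType) d (u v : T -> 'rV[R]_d) :
  (forall i, continuous (fun z => u z ord0 i)) ->
  (forall i, continuous (fun z => v z ord0 i)) ->
  continuous (fun z => edot (u z) (v z)).
Proof.
move=> uc vc; apply: continuous_sum => i z.
by apply: cvgM; [exact: uc | exact: vc].
Qed.

Lemma compact_simplex N : compact (@simplex N).
Proof.
have box : compact [set c : 'rV[R]_N | forall i, `[0, 1]%classic (c ord0 i)].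
  by apply: (@rV_compact R N (fun=> `[0, 1]%classic)) => i; exact: segment_compact.
have cl : closed [set c : 'rV[R]_N | \sum_(i < N) c ord0 i = 1].
  apply: (preimage_closed (f := fun c : 'rV[R]_N => \sum_i c ord0 i) (D := [set 1])).
    by move=> c _; apply: continuous_sum => i; exact: coord_continuous.
  exact: closed_eq.
suff -> : @simplex N = [set c : 'rV[R]_N | forall i, `[0, 1]%classic (c ord0 i)]
    `&` [set c : 'rV[R]_N | \sum_(i < N) c ord0 i = 1].
  exact: compact_closedI.
apply/seteqP; split => c /= [c0 c1]; split => // i; last first.
  by have /= := c0 i; rewrite in_itv /= => /andP[].
rewrite in_itv /= c0 -c1 (bigD1 i) //= lerDl sumr_ge0 // => j _; exact: c0.
Qed.

(* The point y is read off a maximiser c of the concave dual function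
   h c = \sum_i c_i (|Y_i|^2 - |x - X_i|^2) - |\sum_i c_i Y_i|^2 on the simplex,
   namely y = \sum_i c_i Y_i: the first-order condition in the direction of the
   i-th vertex is |Y_i - y|^2 - |x - X_i|^2 <= h c, and h <= 0 everywhere. *)
Lemma kirszbraun_point a b N (X : 'M[R]_(N, a)) (Y : 'M[R]_(N, b)) :
  (forall i j, enorm (row i Y - row j Y) <= enorm (row i X - row j X)) ->
  forall x, exists y, forall i, enorm (row i Y - y) <= enorm (row i X - x).
Proof.
(* Without points the simplex is empty and has no maximiser, but then any [y] works. *)
case: N X Y => [X Y _ x|N X Y XY x]; first by exists 0 => i; have := ltn_ord i.
pose l := \row_i (edot (row i Y) (row i Y) - edot (x - row i X) (x - row i X)).
pose h (c : 'rV[R]_N.+1) := edot c l - edot (c *m Y) (c *m Y).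
have hcont : continuous h.
  have lin d (A : 'M[R]_(N.+1, d)) i :
      continuous (fun c : 'rV[R]_N.+1 => (c *m A) ord0 i).
    have -> : (fun c : 'rV[R]_N.+1 => (c *m A) ord0 i) =
        (fun c => edot c (col i A)^T).
      by apply/funext => z; rewrite mxE; apply: eq_bigr => j _; rewrite !mxE.
    apply: continuous_edot => j; first exact: coord_continuous.
    by move=> z; exact: cst_continuous.
  have hl : continuous (fun c : 'rV[R]_N.+1 => edot c l).
    apply: continuous_edot => j; first exact: coord_continuous.
    by move=> z; exact: cst_continuous.
  have hY : continuous (fun c : 'rV[R]_N.+1 => edot (c *m Y) (c *m Y)).
    by apply: continuous_edot; exact: lin.
  by move=> c; exact: (@continuousB _ _ _ _ _ c (hl c) (hY c)).
have s0 : @simplex N.+1 !=set0.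
  exists (delta_mx 0 ord0); split => [i|]; first by rewrite mxE ler0n.
  rewrite (bigD1 ord0) //= mxE !eqxx big1 ?addr0 // => i /negPf i0.
  by rewrite mxE i0 andbF.
have [c] := compact_EVT_max s0 (@compact_simplex N.+1)
  (continuous_subspaceT hcont).
rewrite inE => -[c0 c1] cmax.
(* The weighted variance of the rows of [Y] is at most that of the rows of [X], itself at most the
   second moment of the latter about [x]. *)
have hle0 : h c <= 0.
  have H1 := weighted_pairwise_edot X c1.
  have H2 := weighted_pairwise_edot Y c1.
  have H3 := weighted_edot_ge X x c1.
  have H4 : \sum_(i < N.+1) \sum_(j < N.+1) c ord0 i * c ord0 j *
      edot (row i Y - row j Y) (row i Y - row j Y) <=
    \sum_(i < N.+1) \sum_(j < N.+1) c ord0 i * c ord0 j *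
      edot (row i X - row j X) (row i X - row j X).
    apply: ler_sum => i _; apply: ler_sum => j _; apply: ler_wpM2l.
      by rewrite mulr_ge0.
    by rewrite -!sqr_enorm lerXn2r ?nnegrE ?enorm_ge0.
  have -> : h c = \sum_i c ord0 i * edot (row i Y) (row i Y)
     - \sum_i c ord0 i * edot (x - row i X) (x - row i X)
     - edot (c *m Y) (c *m Y).
    congr (_ - _); rewrite -sumrB; apply: eq_bigr => i _.
    by rewrite mxE mulrBr.
  by lra.
exists (c *m Y) => i; rewrite -(@ler_pXn2r _ 2) ?nnegrE ?enorm_ge0 //.
rewrite (enormBC (row i X)) !sqr_enorm.
set y := c *m Y in hle0 *.
set M := edot (row i Y - y) (row i Y - y).
(* [D] is the derivative of [h] at [c] towards the [i]-th vertex, and [- M] is the quadratic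
   coefficient along that segment. *)
pose D := M - edot (x - row i X) (x - row i X) - h c.
suff D0 : D <= 0 by move: D0; rewrite /D; lra.
have M0 : 0 <= M by exact: edot_ge0.
have step t : 0 < t <= 1 -> D <= t * M.
  move=> /andP[t0 t1].
  pose c' := (1 - t) *: c + t *: delta_mx 0 i.
  have c's : @simplex N.+1 c'.
    split => [j|].
      by rewrite !mxE addr_ge0 ?mulr_ge0 ?ler0n ?subr_ge0 // ltW.
    rewrite (eq_bigr (fun j => (1 - t) * c ord0 j + t * (j == i)%:R)); last first.
      by move=> j _; rewrite !mxE eqxx.
    rewrite big_split /= -!mulr_sumr c1 (bigD1 i) //= eqxx big1.
      by rewrite addr0 !mulr1 subrK.
    by move=> j /negPf ->.
  have := cmax c'; rewrite inE => /(_ c's).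
  have -> : h c' = h c + t * D - t ^+ 2 * M.
    have dl : edot (delta_mx 0 i) l = edot (row i Y) (row i Y)
        - edot (x - row i X) (x - row i X).
      rewrite /edot (bigD1 i) //= !mxE !eqxx mul1r big1 ?addr0 // => j /negPf ji.
      by rewrite mxE ji andbF mul0r.
    rewrite /D /M /h -/y mulmxDl -!scalemxAl -rowE -/y.
    rewrite !(edotDl, edotDr, edotNl, edotNr, edotZl, edotZr) dl.
    rewrite (edotC y (row i Y)).
    rewrite !(edotDl, edotDr, edotNl, edotNr).
    by ring.
  move=> H; rewrite -(ler_pM2l t0); lra.
rewrite leNgt; apply/negP => D0.
have MD : 0 < M + D by lra.
(* Dividing by [M + D] rather than [M] covers [M = 0] and keeps the step at most 1; the half turns
   [step] into [D <= D / 2], which is absurd. *)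
have := step (D / (M + D) / 2).
have : 0 < D / (M + D) by rewrite divr_gt0.
have : D / (M + D) <= 1 by rewrite ler_pdivrMr // mul1r lerDr.
have : D / (M + D) * M <= D.
  by rewrite mulrAC ler_pdivrMr // ler_pM2l // lerDl ltW.
set s := D / (M + D) => sM s1 s0' /(_ _)/implyP.
have -> /= : 0 < s / 2 <= 1 by lra.
by move=> H; lra.
Qed.

End EuclideanDot.

(** Scaling [f1] and [u] by [L] reduces this to the nonexpansive case. Two maps on a common index
    set, instead of one map between images, allow projection and identity to exchange roles. *)
Lemma lipschitz_point_extension (R : realType) (T : choiceType) (a b : nat)
    (X : {fset T}) (f1 : T -> 'rV[R]_a) (f2 : T -> 'rV[R]_b) (L : R) :
  0 <= L ->
  {in X &, forall x y, enorm (f2 x - f2 y) <= L * enorm (f1 x - f1 y)} ->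
  forall u, exists v, {in X, forall x, enorm (f2 x - v) <= L * enorm (f1 x - u)}.
Proof.
move=> L0 f12 u.
pose pt (i : 'I_#|{: X}|) : T := fsval (enum_val i).
have [|v hv] := @kirszbraun_point R a b _
  (\matrix_i (L *: f1 (pt i))) (\matrix_i f2 (pt i)) _ (L *: u).
  by move=> i j; rewrite !rowK -scalerBr enormZ // f12 // fsvalP.
exists v => x xX; have := hv (enum_rank [` xX]%fset).
by rewrite !rowK -scalerBr enormZ // /pt enum_rankK.
Qed.

(** * Costs of two images of the same weighted points *)

Section CostComparison.
Variables (R : realType) (d n k : nat) (p : R).
Variables (X : {fset 'rV[R]_d}) (w : 'I_n -> 'rV[R]_d -> R).
Hypothesis w_ge0 : forall j x, 0 <= w j x.
Hypothesis w_supp : forall j x, x \notin X -> w j x = 0.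

(** Points of [X] outside [solution_set w j] have weight zero, so every cluster can be summed over
    the same finite set. *)
Lemma sum_solution_set (j : 'I_n) (F : 'rV[R]_d -> R) :
  \sum_(x \in solution_set w j) w j x * F x = \sum_(x <- X) w j x * F x.
Proof.
rewrite (@fsbig_widen _ _ _ _ _ [set` X]).
- by rewrite -fsbig_seq // fset_uniq.
- move=> x /= wx; apply: contraT => /w_supp wx0.
  by move: wx; rewrite /solution_set /= wx0 ltxx.
- move=> x [_ /= /negP]; rewrite -leNgt => wx.
  have -> : w j x = 0 by apply/eqP; rewrite eq_le wx w_ge0.
  by rewrite mul0r.
Qed.

Lemma cost_term_ge0 (a : nat) (f : 'rV[R]_d -> 'rV[R]_a) nu :
  0 <= k%:R^-1 * \sum_(j < n) \sum_(x \in solution_set w j)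
                   w j x * enorm (f x - nu j) `^ p.
Proof.
rewrite mulr_ge0 ?invr_ge0 ?ler0n //; apply: sumr_ge0 => j _.
rewrite sum_solution_set; apply: sumr_ge0 => x _.
by rewrite mulr_ge0 ?powR_ge0.
Qed.

Lemma cost_image_ge0 (a : nat) (f : 'rV[R]_d -> 'rV[R]_a) :
  0 <= cost_image p k f w.
Proof.
apply: lb_le_inf; first by eexists; exists (fun=> 0); reflexivity.
by move=> _ [nu ->]; exact: cost_term_ge0.
Qed.

Lemma cost_image_lipschitz (a b : nat) (f1 : 'rV[R]_d -> 'rV[R]_a)
    (f2 : 'rV[R]_d -> 'rV[R]_b) (L : R) :
  0 <= p -> 0 < L ->
  {in X &, forall x y, enorm (f2 x - f2 y) <= L * enorm (f1 x - f1 y)} ->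
  cost_image p k f2 w <= L `^ p * cost_image p k f1 w.
Proof.
move=> p0 L0 f12; rewrite -ler_pdivrMl ?powR_gt0 //.
apply: lb_le_inf; first by eexists; exists (fun=> 0); reflexivity.
move=> _ [nu ->]; rewrite ler_pdivrMl ?powR_gt0 //.
(* The cost never compares two centers, so each [nu j] is transferred separately by a one-point
   extension. *)
have /choice[nu' hnu'] j := lipschitz_point_extension (ltW L0) f12 (nu j).
apply: (@le_trans _ _ (k%:R^-1 * \sum_(j < n) \sum_(x \in solution_set w j)
                    w j x * enorm (f2 x - nu' j) `^ p)).
  apply: ge_inf; last by exists nu'.
  by exists 0 => _ [z ->]; exact: cost_term_ge0.
rewrite mulrCA ler_wpM2l ?invr_ge0 ?ler0n // mulr_sumr; apply: ler_sum => j _.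
rewrite !sum_solution_set mulr_sumr big_seq [leRHS]big_seq.
apply: ler_sum => x xX; rewrite mulrCA ler_wpM2l //.
rewrite -powRM ?enorm_ge0 ?(ltW L0) // ge0_ler_powR ?nnegrE ?enorm_ge0 //.
  by rewrite mulr_ge0 ?enorm_ge0 ?ltW.
exact: hnu'.
Qed.

End CostComparison.

(** * Estimates for the distortion and the logarithm *)

Lemma distortion_bounds (R : realType) (p eps : R) :
  1 <= p -> 0 < eps < 1 -> 0 < eps / (2 * p) <= 1 / 2.
Proof.
move=> p1 /andP[eps0 eps1].
have p0 : 0 < 2 * p by lra.
by apply/andP; split; [rewrite divr_gt0 //|rewrite ler_pdivrMr //]; lra.
Qed.

Lemma mul_distortion (R : realType) (p eps : R) :
  1 <= p -> p * (eps / (2 * p)) = eps / 2.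
Proof. by move=> p1; field; rewrite gt_eqF // (lt_le_trans ltr01). Qed.

(** With [e = eps / (2 * p)], the power is at most [expR (p * e) = expR (eps / 2)], hence at most
    [(1 - eps / 2)^-1], which is below [1 + eps] because [eps < 1]. *)
Lemma powR_distortion_le (R : realType) (p eps : R) :
  1 <= p -> 0 < eps < 1 -> (1 + eps / (2 * p)) `^ p <= 1 + eps.
Proof.
move=> p1 eps01; have := distortion_bounds p1 eps01.
have := mul_distortion eps p1; set e := eps / _ => pe /andP[e0 e2].
case/andP: eps01 => eps0 eps1.
rewrite /powR gt_eqF; last by lra.
have le_e : p * ln (1 + e) <= eps / 2.
  by rewrite -pe ler_wpM2l ?le_ln1Dx //; lra.
apply: (@le_trans _ _ (expR (eps / 2))); first by rewrite ler_expR.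
have := expR_ge1Dx (- (eps / 2)); rewrite expRN.
have E0 := expR_gt0 (eps / 2).
move=> /(ler_wpM2r (ltW E0)); rewrite mulVf ?gt_eqF // => H.
have : (1 + eps) * ((1 - eps / 2) * expR (eps / 2)) <= 1 + eps by nra.
have : 1 <= (1 + eps) * (1 - eps / 2) by nra.
move=> H1 H2; nra.
Qed.

(** For [e <= 1 / 2], [- ln (1 - e) <= (1 - e)^-1 - 1 <= 2 * e], so the power is at least
    [expR (- eps) >= 1 - eps]. *)
Lemma powR_distortion_ge (R : realType) (p eps : R) :
  1 <= p -> 0 < eps < 1 -> 1 - eps <= (1 - eps / (2 * p)) `^ p.
Proof.
move=> p1 eps01; have := distortion_bounds p1 eps01.
have := mul_distortion eps p1; set e := eps / _ => pe /andP[e0 e2].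
case/andP: eps01 => eps0 eps1.
rewrite /powR gt_eqF; last by lra.
apply: (le_trans (expR_ge1Dx (- eps))); rewrite ler_expR.
have i0 : 0 < (1 - e)^-1 by rewrite invr_gt0; lra.
have le_i : (1 - e)^-1 <= 1 + 2 * e.
  by rewrite -[leLHS]div1r ler_pdivrMr; nra.
have := @le_ln1Dx _ ((1 - e)^-1 - 1).
rewrite addrCA subrr addr0 lnV ?posrE; last by lra.
move=> /(_ _)/implyP; have -> /= : -1 < (1 - e)^-1 - 1 by lra.
move=> H; have : - ln (1 - e) <= 2 * e by lra.
move=> /(ler_wpM2l (ltW (lt_le_trans ltr01 p1))); rewrite mulrN mulrCA pe.
by lra.
Qed.

(** Follows from [K <= 2 ^ K <= x ^ K]; it absorbs a constant factor into a multiple of [ln x]. *)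
Lemma ln_le_natM (R : realType) (K : nat) (x : R) :
  2 <= x -> (0 < K)%N -> ln K%:R <= K%:R * ln x.
Proof.
move=> x2 K0; rewrite [leRHS]mulr_natl -lnXn; last by lra.
rewrite ler_ln ?posrE ?ltr0n ?exprn_gt0 //; last by lra.
apply: (@le_trans _ _ (2 ^+ K)); last by rewrite lerXn2r ?nnegrE //; lra.
by rewrite -natrX ler_nat ltnW // ltn_expl.
Qed.

(** Put [z = n * k / delta]. Both [n] and [k / delta] are at most [z], so
    [N / delta <= K * z ^ (c + 1)], and [ln K] is absorbed into [K * ln z]. *)
Lemma ln_support_bound (R : realType) (K c n k N : nat) (delta : R) :
  (0 < N <= k * (K * n ^ c))%N -> 0 < delta < 1 ->
  2 <= (n * k)%:R / delta ->
  ln (N%:R / delta) <= (K + c + 1)%:R * ln ((n * k)%:R / delta).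
Proof.
move=> /andP[N0 NK] /andP[d0 d1] nk.
have n0 : (0 < n)%N.
  rewrite lt0n; apply: contraTN nk => /eqP ->.
  by rewrite mul0n mul0r -ltNge ltr0n.
move: nk; set z := _ / delta => z2.
have z0 : 0 < z by lra.
have := leq_trans N0 NK; rewrite !muln_gt0 => /and3P[k0 K0 _].
have k1 : 1 <= k%:R :> R by rewrite ler1n.
have nz : n%:R <= z.
  rewrite /z ler_pdivlMr // natrM; have := ler0n R n; nra.
have kz : k%:R / delta <= z.
  by rewrite /z ler_pM2r ?invr_gt0 // ler_nat leq_pmull.
have Nz : N%:R / delta <= K%:R * z ^+ (c + 1).
  apply: (@le_trans _ _ ((k * (K * n ^ c))%:R / delta)).
    by rewrite ler_pM2r ?invr_gt0 // ler_nat.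
  rewrite !natrM natrX addn1 exprSr.
  rewrite [leLHS](_ : _ = K%:R * (n%:R ^+ c * (k%:R / delta))); last by ring.
  rewrite ler_wpM2l // ler_pM ?exprn_ge0 ?divr_ge0 ?(ltW d0) //.
  by rewrite lerXn2r ?nnegrE // ltW.
apply: (@le_trans _ _ (ln (K%:R * z ^+ (c + 1)))).
  by rewrite ler_ln ?posrE ?divr_gt0 ?mulr_gt0 ?exprn_gt0 ?ltr0n.
rewrite lnM ?posrE ?ltr0n ?exprn_gt0 // lnXn // -addnA natrD mulrDl.
by rewrite -(mulr_natl (ln z)) lerD2r ln_le_natM.
Qed.

(** * Points that carry a solution *)

Lemma card_bigfcup_le (I : eqType) (T : choiceType) (B : nat) (r : seq I)
    (F : I -> {fset T}) :
  (forall i, #|` F i| <= B)%N ->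
  (#|` (\bigcup_(i <- r) F i)%fset| <= size r * B)%N.
Proof.
move=> FB; elim: r => [|i r IH]; first by rewrite big_nil cardfs0.
by rewrite big_cons mulSn (leq_trans (leq_card_fsetU _ _)) // leq_add.
Qed.

(** Off the supports each row of a coupling has nonnegative entries with sum zero, so all of them
    vanish. *)
Lemma solution_ge0_supp (R : realType) (d n k : nat) (p : R)
    (mu : 'I_k -> mass_fun R d) (w : 'I_n -> 'rV[R]_d -> R) :
  is_solution p mu w ->
  (forall j x, 0 <= w j x) /\
  (forall j x, x \notin (\bigcup_(i <- enum 'I_k) finsupp (mu i))%fset -> w j x = 0).
Proof.
move=> [nu [b [g [_ _ gopt wE]]]].
split => j x; rewrite wE.
  by apply: sumr_ge0 => i _; have [[g0 _ _] _] := gopt i; exact: g0.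
move=> xX; apply: big1 => i _; have [[g0 gmu _] _] := gopt i.
have mux : mu i x = 0.
  apply: fsfun_dflt; apply: contra xX => xi.
  by apply/bigfcupP; exists i; rewrite ?mem_enum.
have /eqP := gmu x; rewrite mux psumr_eq0 // => /allP/(_ j).
by rewrite mem_index_enum => /(_ isT)/eqP.
Qed.

(** * Dimension count and the event common to all solutions *)

Theorem theorem12 (R : realType) (C0 : R) (K c : nat) (hC0 : 0 < C0) :
  exists2 C : R, 0 < C &
  forall (p : R) (n k d m : nat) (mu : 'I_k -> mass_fun R d) (eps delta : R)
         (disp : measure_display) (T : measurableType disp)
         (P : probability T R) (pi : T -> 'M[R]_(d, m)),
    1 <= p -> p != 2 ->
    2 <= (n * k)%:R / delta ->
    (forall i, is_discrete_distribution (mu i)) ->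
    (forall i, (#|` finsupp (mu i)| <= K * n ^ c)%N) ->
    0 < eps < 1 -> 0 < delta < 1 ->
    C * (ln ((n * k)%:R / delta) * p ^+ 2 / eps ^+ 2) <= m%:R ->
    is_JL_projection C0 P pi ->
    prob_ge P
      [set t | forall w : 'I_n -> 'rV[R]_d -> R, is_solution p mu w ->
         (1 - eps) * cost p k w <= cost_proj p k (pi t) w
           <= (1 + eps) * cost p k w]
      (1 - delta).
Proof.
(* The 4 comes from [1 / e ^ 2 = 4 * p ^ 2 / eps ^ 2] for [e = eps / (2 * p)], and [K + c + 1] from
   [ln_support_bound]. *)
exists (4 * C0 * (K + c + 1)%:R).
  by rewrite !mulr_gt0 // ltr0n addn1.
move=> p n k d m mu eps delta disp T P pi p1 _ nk mu1 muK eps01 delta01 hm [_ JL].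
pose X := (\bigcup_(i <- enum 'I_k) finsupp (mu i))%fset.
pose e := eps / (2 * p).
have /andP[e0 e2] : 0 < e <= 1 / 2 := distortion_bounds p1 eps01.
(* The bound [2 <= n * k / delta] excludes [k = 0], and a distribution of mass one has nonempty
   support. *)
have X0 : (0 < #|` X|)%N.
  case: k mu nk mu1 muK hm @X => [|k] mu nk mu1 muK hm X.
    by move: nk; rewrite muln0 mul0r; lra.
  have [_] := mu1 ord0.
  rewrite cardfs_gt0; apply: contra_eqN => /eqP XE.
  have -> : finsupp (mu ord0) = fset0.
    apply/eqP; rewrite -fsubset0 -XE; apply/fsubsetP => x xmu.
    by apply/bigfcupP; exists ord0; rewrite ?mem_enum.
  by rewrite big_seq_fset0 eq_sym oner_eq0.
have XK : (#|` X| <= k * (K * n ^ c))%N.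
  by rewrite -[k in leqRHS]card_ord cardE; exact: card_bigfcup_le.
have [||A [mA AE PA]] := JL X e delta X0 _ delta01.
- by lra.
- apply: le_trans hm.
  have := @ln_support_bound R K c n k #|` X| delta.
  rewrite X0 XK => /(_ isT delta01 nk) hln.
  have pE : (e ^+ 2)^-1 = 4 * (p ^+ 2 / eps ^+ 2).
    by rewrite /e; field; rewrite !gt_eqF //; lra.
  rewrite pE.
  have q0 : 0 <= p ^+ 2 / eps ^+ 2 by rewrite divr_ge0 ?sqr_ge0.
  rewrite [leLHS](_ : _ =
    4 * C0 * (p ^+ 2 / eps ^+ 2) * ln (#|` X|%:R / delta)); last by ring.
  rewrite [leRHS](_ : _ = 4 * C0 * (p ^+ 2 / eps ^+ 2) *
    ((K + c + 1)%:R * ln ((n * k)%:R / delta))); last by ring.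
  by rewrite ler_wpM2l // mulr_ge0 // mulr_ge0 // ltW.
(* [A] depends on [X] but not on [w], so one event serves all solutions without a union bound. *)
exists A; split => // t /AE /= At w /solution_ge0_supp[w0 wX].
have cost0 : 0 <= cost p k w := cost_image_ge0 k p w0 wX _.
have p0 : 0 <= p by lra.
apply/andP; split.
  (* Lower bound: on [X] the inverse of the projection is Lipschitz with constant [(1 - e)^-1], so
     the comparison runs from the projected points back to the original ones. *)
  have i0 : 0 < (1 - e)^-1 by rewrite invr_gt0; lra.
  have := @cost_image_lipschitz R d n k p X w w0 wX m d
    (fun x => x *m pi t) id (1 - e)^-1 p0 i0.
  move=> /(_ _)/wrap[].
    move=> x y xX yX; have /andP[+ _] := At x y xX yX.
    by rewrite ler_pdivlMl; [|lra].
  rewrite -powR_inv1; last by lra.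
  rewrite -powRrM mulN1r powRN ler_pdivlMl; last by rewrite powR_gt0 //; lra.
  by apply: le_trans; rewrite ler_wpM2r // powR_distortion_ge.
apply: (@le_trans _ _ ((1 + e) `^ p * cost p k w)).
  have e1 : 0 < 1 + e by lra.
  apply: (@cost_image_lipschitz R d n k p X w w0 wX d m id
    (fun x => x *m pi t) (1 + e) p0 e1).
  by move=> x y xX yX; have /andP[] := At x y xX yX.
by rewrite ler_wpM2r // powR_distortion_le.
Qed.
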